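(* Consider the exponential family mixture model described in the context, and suppose that $M<\infty$ and that there exists $\tau>0$ with $[-M-\tau,M+\tau]\subseteq\Theta$. Let $A>0$ be a constant and let $\tilde g\in\mathcal{G}$ be an approximate NPMLE satisfying $$\ell_n(f_{\hat g})-\ell_n(f_{\tilde g})\le A(\log n)^2 .$$ Then there exists a constant $C_{p_0,M,A}>0$, depending only on $p_0$, $M$ and $A$, such that $$\mathbb{P}\Big(H^2(f_{\tilde g},f_{g_0})\ge t\,C_{p_0,M,A}\frac{(\log n)^2}{n}\Big)\le\exp\big(-t(\log n)^2\big)$$ for all $t\ge 1$ and $n\ge 1$.
   Context: Exponential family mixture model. Let $p_0$ be a probability density on $\mathbb{R}$ with respect to a dominating measure $\mu$. Put $Z(\theta)=\int \exp(\theta x)p_0(x)\,\mathrm{d}\mu(x)$, $\kappa(\theta)=\log Z(\theta)$, $\Theta=\{\theta\in\mathbb{R}:Z(\theta)<\infty\}$, and $p_\theta(x)=\exp(\theta x-\kappa(\theta))p_0(x)$ for $\theta\in\Theta$. Let $M\in(0,\infty]$ be known with $\Theta_0=\{\theta\in\mathbb{R}:|\theta|\le M\}\subseteq\Theta$, and let $\mathcal{G}$ be the set of probability distributions $g$ with $\mathrm{supp}(g)\subseteq\Theta_0$. For $g\in\mathcal{G}$ let $f_g(x)=\int p_\theta(x)\,\mathrm{d}g(\theta)$. The observations $X_1,\dots,X_n$ are i.i.d. with density $f_{g_0}$ (with respect to $\mu$) for some $g_0\in\mathcal{G}$. Notation. $\ell_n(f)=\sum_{i=1}^n\log f(X_i)$.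 The NPMLE $\hat g$ is any maximizer of $\ell_n(f_g)$ over $g\in\mathcal{G}$. An approximate NPMLE $\tilde g$ is a data-dependent element of $\mathcal{G}$. The squared Hellinger distance between densities $f,f_0$ with respect to $\mu$ is $H^2(f,f_0)=\int(\sqrt{f(x)}-\sqrt{f_0(x)})^2\,\mathrm{d}\mu(x)$. *)

(* Defs.v *)
From HB Require Import structures.
From mathcomp Require Import all_boot all_order all_algebra.
From mathcomp Require Import all_classical all_reals all_analysis.
From mathcomp Require Import measurable_realfun.

Set Implicit Arguments.
Unset Strict Implicit.
Unset Printing Implicit Defensive.

Import Order.TTheory GRing.Theory Num.Theory.
Import numFieldNormedType.Exports.

Local Open Scope classical_set_scope.
Local Open Scope ring_scope.

Section density.
Context {R : realType}.
Implicit Types (mu : {measure set R -> \bar R}) (f : R -> R).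

Definition is_density mu f : Prop :=
  [/\ measurable_fun [set: R] f,
      forall x, 0 <= f x &
      (\int[mu]_x (f x)%:E = 1)%E].

(* H^2(f, f0), without the normalizing factor 1/2. *)
Definition hellinger2 mu f f0 : \bar R :=
  (\int[mu]_x (((Num.sqrt (f x) - Num.sqrt (f0 x)) ^+ 2)%:E))%E.

(* The logarithm is the extended one (lne 0 = -oo), since the real one has
   ln 0 = 0. *)
Definition loglik n f (x : 'I_n -> R) : \bar R :=
  (\sum_(i < n) lne (f (x i))%:E)%E.

Definition msupport (g : probability R R) : set R :=
  [set x | forall U : set R, open U -> U x -> (0 < g U)%E].

End density.

Section mixture.
Context {R : realType} (mu : {measure set R -> \bar R}) (p0 : R -> R).

Definition partition_fun (theta : R) : \bar R :=
  (\int[mu]_x (expR (theta * x) * p0 x)%:E)%E.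

Definition natural_space : set R :=
  [set theta | (partition_fun theta < +oo)%E].

(* kappa and expfam are only meaningful for theta in natural_space, where the
   partition function is finite and positive. *)
Definition kappa (theta : R) : R := ln (fine (partition_fun theta)).

Definition expfam (theta x : R) : R := expR (theta * x - kappa theta) * p0 x.

Definition mixture (g : probability R R) (x : R) : R :=
  \int[g]_(theta in natural_space) expfam theta x.

Definition param_space (M : R) : set R := [set theta | `|theta| <= M].

Definition mixing (M : R) : set (probability R R) :=
  [set g | msupport g `<=` param_space M].

Definition is_npmle (M : R) n (x : 'I_n -> R) (g : probability R R) : Prop :=
  mixing M g /\
  forall h, mixing M h -> (loglik (mixture h) x <= loglik (mixture g) x)%E.

End mixture.

Section sample.
Context {R : realType} {d : measure_display} {T : measurableType d}.
Variables (P : probability T R) (n : nat) (X : 'I_n -> {RV P >-> R}).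

(* For a finite family, the product rule over all Borel B_i contains the one
   for subfamilies (take B_i = setT). *)
Definition mutually_independent : Prop :=
  forall B : 'I_n -> set R, (forall i, measurable (B i)) ->
    P (\bigcap_(i in [set: 'I_n]) (X i @^-1` B i)) =
    (\prod_(i < n) P (X i @^-1` B i))%E.

Definition iid_density (mu : {measure set R -> \bar R}) (f : R -> R) : Prop :=
  mutually_independent /\
  forall i (B : set R), measurable B ->
    distribution P (X i) B = (\int[mu]_(x in B) (f x)%:E)%E.

End sample.

(* Main.v *)
(* Write f_g(x) = p0(x) * q_g(x) with q_g(x) = int exp(t x) W(t) dg(t), where
   W(t) = exp(-kappa(t)) on [-M, M] and 0 elsewhere. Cutting the Taylor series
   of exp(t x) after K terms costs at most rho^K exp((M + tau)|x|), where
   rho = M / (M + tau), so q_g is determined up to an error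
   eta * exp((M + tau)|x|) by K scaled moments of W dg, each rounded to a
   multiple of n^-2; here K is of order log n and eta of order n^-2. Since
   exp((M + tau)|x|) p0(x) is integrable, this cuts the mixing distributions
   into exp(O((log n)^2)) cells, on each of which all the densities lie below
   f + r, where f is any density of the cell and int r = O(n^-2).
   Fix a cell containing a density f with H^2(f, f0) >= s. If the approximate
   NPMLE falls in that cell, then the product of the
   sqrt((f + r)(X_i) / f0(X_i)) is at least exp(-A (log n)^2 / 2), whereas by
   independence its expectation is the n-th power of
   int sqrt((f + r) f0) <= 1 - s/2 + O(1/n). Markov's inequality and a union
   bound over the cells conclude. *)

Require Import Defs.
From HB Require Import structures.
From mathcomp Require Import all_boot all_order all_algebra.
From mathcomp Require Import all_classical all_reals all_analysis.
From mathcomp Require Import measurable_realfun.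
From mathcomp Require Import ring lra.

Set Implicit Arguments.
Unset Strict Implicit.
Unset Printing Implicit Defensive.

Import Order.TTheory GRing.Theory Num.Theory.
Import numFieldNormedType.Exports.

Local Open Scope classical_set_scope.
Local Open Scope ring_scope.

(** * Integrals of functions of a map against a nonnegative weight *)

Section weighted_integral.
Local Open Scope ereal_scope.
Context {d : measure_display} {T : measurableType d}.
Context {d' : measure_display} {T' : measurableType d'} {R : realType}.

Import HBNNSimple.

(** For a simple [h] the integral depends on [X], [w] and [mu] only through the [w]-weighted masses
    of preimages under [X]; this is what allows two such integrals to be compared. *)
Lemma integral_nnsfun_weight (mu : {measure set T -> \bar R}) (X : T -> T')
    (w : T -> \bar R) (h : {nnsfun T' >-> R}) :
  measurable_fun [set: T] X -> measurable_fun [set: T] w ->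
  (forall x, 0 <= w x) ->
  \int[mu]_x ((h (X x))%:E * w x) =
  \sum_(y \in range h) (y%:E * \int[mu]_(x in X @^-1` (h @^-1` [set y])) w x).
Proof.
move=> mX mw w0.
have mXh y : measurable (X @^-1` (h @^-1` [set y])).
  by rewrite -[X in measurable X]setTI; apply: mX.
transitivity (\int[mu]_x (\sum_(y \in range h)
    (y%:E * (w \_ (X @^-1` (h @^-1` [set y]))) x))).
  apply: eq_integral => x _; rewrite fimfunE -fsumEFin // ge0_mule_fsuml;
    last first.
    by move=> y; exact: nnfun_muleindic_ge0.
  apply: eq_fsbigr => y _; rewrite EFinM -muleA; congr (_ * _).
  rewrite patchE indicE; case: ifPn => [/set_mem /= <-|].
    by rewrite mem_set//= mul1e.
  by move=> /negP xy; rewrite memNset ?mul0e// => ?; apply: xy; rewrite inE.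
have wr0 y x : 0 <= (w \_ (X @^-1` (h @^-1` [set y]))) x.
  by apply: erestrict_ge0.
rewrite ge0_integral_fsum//.
- apply: eq_fsbigr => y /set_mem [z _ <-].
  rewrite ge0_integralZl//; first by rewrite -integral_mkcond.
    by apply/(measurable_restrictT _ _).1 => //; exact: measurable_funTS.
  by rewrite lee_fin.
- move=> y; apply: emeasurable_funM => //.
  by apply/(measurable_restrictT _ _).1 => //; exact: measurable_funTS.
- move=> y x _; have [[z _ <-]|ny] := pselect (range h y).
    by rewrite mule_ge0 ?lee_fin.
  rewrite patchE; case: ifPn => [/set_mem/= hy|]; last by rewrite mule0.
  by exfalso; apply: ny; exists (X x).
Qed.

Lemma integral_weight_cvg (mu : {measure set T -> \bar R}) (X : T -> T')
    (w : T -> \bar R) (f : T' -> \bar R) (mf : measurable_fun [set: T'] f) :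
  measurable_fun [set: T] X -> measurable_fun [set: T] w ->
  (forall x, 0 <= w x) -> (forall y, 0 <= f y) ->
  \int[mu]_x (f (X x) * w x) =
  limn (fun n => \int[mu]_x ((nnsfun_approx measurableT mf n (X x))%:E * w x)).
Proof.
move=> mX mw w0 f0; rewrite -monotone_convergence//.
- apply: eq_integral => x _; apply/esym/cvg_lim => //.
  have cf : (EFin \o (nnsfun_approx measurableT mf)^~ (X x)) @ \oo --> f (X x).
    exact: cvg_nnsfun_approx.
  have nd : {homo (fun n => (nnsfun_approx measurableT mf n (X x))%:E * w x) :
      m n / (m <= n)%N >-> m <= n}.
    by move=> m n mn; rewrite lee_wpmul2r// lee_fin;
      exact/lefP/nd_nnsfun_approx.
  have := ereal_nondecreasing_cvgn nd.
  have ndf : {homo (fun n => (nnsfun_approx measurableT mf n (X x))%:E) :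
      m n / (m <= n)%N >-> m <= n}.
    by move=> m n mn; rewrite lee_fin; exact/lefP/nd_nnsfun_approx.
  have fE := cvg_unique _ cf (ereal_nondecreasing_cvgn ndf).
  suff -> : ereal_sup (range
      (fun n => (nnsfun_approx measurableT mf n (X x))%:E * w x)) =
      f (X x) * w x by [].
  have [wfin|] := boolP (w x \is a fin_num).
    apply: cvg_unique (ereal_nondecreasing_cvgn nd) _.
      exact: ereal_hausdorff.
    exact: cvgeZr.
  (* Multiplication by [+oo] is not continuous at 0, so the supremum is found by hand: if [f (X x)]
     is positive, some approximant is positive and its product is already [+oo]. *)
  rewrite ge0_fin_numE// -leNgt leye_eq => /eqP wy; rewrite wy.
  apply/eqP; rewrite eq_le; apply/andP; split.
    apply: ge_ereal_sup => _ [n _ <-]; apply: lee_wpmul2r => //.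
    by rewrite fE//; apply: ereal_sup_ubound; exists n.
  have [->|fn0] := eqVneq (f (X x)) 0.
    rewrite mul0e; apply: (@le_trans _ _ ((nnsfun_approx measurableT mf 0%N (X
      x))%:E * +oo)).
      by rewrite mule_ge0// lee_fin.
    by apply: ereal_sup_ubound; exists 0%N.
  have fgt0 : 0 < f (X x) by rewrite lt0e fn0 f0.
  have [_ [n _ <-] hn] : exists2 y, range
      (fun n => (nnsfun_approx measurableT mf n (X x))%:E) y & 0 < y.
    by apply: ereal_sup_gt; rewrite -fE//; exact: ereal_hausdorff.
  rewrite gt0_muley//; apply: (@le_trans _ _ ((nnsfun_approx measurableT mf n
    (X x))%:E * +oo)).
    by rewrite gt0_muley.
  by apply: ereal_sup_ubound; exists n.
- move=> n; apply: emeasurable_funM => //; apply/measurable_EFinP.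
  exact: measurableT_comp.
- by move=> n x _; rewrite mule_ge0// lee_fin.
- move=> x _ m n mn; rewrite lee_wpmul2r// lee_fin.
  exact/lefP/nd_nnsfun_approx.
Qed.

End weighted_integral.

Section eq_weight.
Import HBNNSimple.

(** Both integrals are limits of the same finite sums. Suitable maps and weights give the law of a
    variable from its density, integration against a measure with a density, and the separation of
    one factor from a product of independent variables. *)
Lemma eq_integral_weight {d1 d2 d' : measure_display} {T1 : measurableType d1}
    {T2 : measurableType d2} {T' : measurableType d'} {R : realType}
    (mu1 : {measure set T1 -> \bar R}) (mu2 : {measure set T2 -> \bar R})
    (X1 : T1 -> T') (X2 : T2 -> T') (w1 : T1 -> \bar R) (w2 : T2 -> \bar R)
    (f : T' -> \bar R) :
  measurable_fun [set: T1] X1 -> measurable_fun [set: T2] X2 ->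
  measurable_fun [set: T1] w1 -> measurable_fun [set: T2] w2 ->
  (forall x, 0 <= w1 x)%E -> (forall x, 0 <= w2 x)%E ->
  (forall B, measurable B ->
     \int[mu1]_(x in X1 @^-1` B) w1 x = \int[mu2]_(x in X2 @^-1` B) w2 x)%E ->
  measurable_fun [set: T'] f -> (forall y, 0 <= f y)%E ->
  (\int[mu1]_x (f (X1 x) * w1 x) = \int[mu2]_x (f (X2 x) * w2 x))%E.
Proof.
move=> mX1 mX2 mw1 mw2 w10 w20 w12 mf f0.
rewrite (integral_weight_cvg _ mf)// (integral_weight_cvg _ mf)//.
congr (lim (_ @ \oo)); apply/funext => n.
rewrite !integral_nnsfun_weight//; apply: eq_fsbigr => y _.
by rewrite w12.
Qed.

End eq_weight.

(** * Expectations of products of independent variables *)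

(** For indicators the formula is the definition of independence; the factors are then freed one at
    a time. *)
Lemma integral_prod_independent {d : measure_display} {T : measurableType d}
    {R : realType} (P : probability T R) n (X : 'I_n -> {RV P >-> R})
    (h : 'I_n -> R -> R) :
  mutually_independent X ->
  (forall i, measurable_fun [set: R] (h i)) -> (forall i x, 0 <= h i x) ->
  (\int[P]_w (\prod_(i < n) h i (X i w))%:E =
   \prod_(i < n) \int[P]_w (h i (X i w))%:E)%E.
Proof.
move=> indX.
have mX (i : 'I_n) (B : set R) : measurable B -> measurable (X i @^-1` B).
  by move=> mB; rewrite -[Z in measurable Z]setTI;
    exact: (measurable_funPT (X i)).
(* The factors of index at least [k] are indicators: all of them for [k = 0], none for [k = n]. *)
suff aux k : forall h : 'I_n -> R -> R, (forall i : 'I_n, (k <= i)%N ->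
      exists2 B, measurable B & h i = \1_B) ->
    (forall i, measurable_fun [set: R] (h i)) -> (forall i x, 0 <= h i x) ->
    (\int[P]_w (\prod_(i < n) h i (X i w))%:E =
     \prod_(i < n) \int[P]_w (h i (X i w))%:E)%E.
  by apply: (aux n) => i; rewrite leqNgt ltn_ord.
elim: k => {h} [|k IH] h hB mh h0.
  have /choice[B BP] : forall i, exists B, measurable B /\ h i = \1_B.
    by move=> i; have [//|B mB ->] := hB i; exists B.
  have mB i : measurable (B i) by have [] := BP i.
  transitivity (P (\bigcap_(i in [set: 'I_n]) (X i @^-1` B i))); last first.
    rewrite indX//; apply: eq_bigr => i _; have [_ ->] := BP i.
    rewrite -[RHS]/(\int[P]_w (\1_(X i @^-1` B i) w)%:E)%E integral_indic
      ?setIT//.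
    exact: mX.
  rewrite -[in RHS](setIT (\bigcap_(i in _) _)) -integral_indic//; last first.
    by apply: fin_bigcap_measurable => // i _; exact: mX.
  apply: eq_integral => w _; congr EFin.
  rewrite indicE; case: (boolP (w \in _)) => [/set_mem wB|/negP wB].
    apply: big1 => i _; have [_ ->] := BP i.
    by rewrite indicE mem_set//; exact: wB.
  have [i nBi] : exists i, ~ B i (X i w).
    by apply/existsNP => wB'; apply: wB; apply/mem_set => i _; exact: wB'.
  by rewrite (bigD1 i)//=; have [_ ->] := BP i; rewrite indicE memNset ?mul0r.
have [nk|kn] := leqP n k.
  by apply: IH => // i ki; have := ltn_ord i; rewrite ltnNge (leq_trans nk ki).
pose i0 := Ordinal kn.
pose W w := \prod_(i < n | i != i0) h i (X i w).
pose c := (\prod_(i < n | i != i0) \int[P]_w (h i (X i w))%:E)%E.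
have c0 : (0 <= c)%E.
  by apply: prode_ge0 => i _; apply: integral_ge0 => w _; rewrite lee_fin.
have W0 w : 0 <= W w by exact: prodr_ge0.
have mW : measurable_fun [set: T] W.
  rewrite (_ : W = fun w => \prod_(i < n) if i != i0 then h i (X i w) else 1).
    apply: measurable_prod => i _; case: (i != i0);
      first exact: measurableT_comp.
    exact: measurable_cst.
  by apply/funext => w; rewrite /W big_mkcond.
transitivity (\int[P]_w ((h i0 (X i0 w))%:E * (W w)%:E))%E.
  by apply: eq_integral => w _; rewrite -EFinM (bigD1 i0).
(* The weight [W], the product of the other factors, is exchanged for the constant [c], the product
   of their expectations. On the preimage of a set [B] the two agree by induction, with [\1_B] in
   place of [h i0]. *)
rewrite (@eq_integral_weight _ _ _ _ _ _ _ P P (X i0) (X i0) (EFin \o W)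
  (cst c) (EFin \o h i0))//; first last.
- by move=> y; rewrite lee_fin.
- exact/measurable_EFinP.
- move=> B mB.
  pose h' i := if i == i0 then \1_B else h i.
  have := IH h'.
  have -> : (\int[P]_w (\prod_(i < n) h' i (X i w))%:E)%E =
     (\int[P]_(x in X i0 @^-1` B) (EFin \o W) x)%E.
    rewrite [RHS]integral_mkcond; apply: eq_integral => w _.
    rewrite (bigD1 i0)//= /h' eqxx (eq_bigr (fun i => h i (X i w))) => [|i
      /negbTE ->//].
    rewrite -/(W w) patchE indicE.
    have -> : (w \in X i0 @^-1` B) = (X i0 w \in B) by apply/idP/idP;
      rewrite !inE.
    by case: ifPn; rewrite ?mul1r ?mul0r.
  move=> ->.
  + rewrite (bigD1 i0)//= [h' i0]/h' eqxx [RHS]integral_cst; last exact: mX.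
    rewrite muleC; congr (_ * _)%E.
      by apply: eq_bigr => i /negbTE ii0; rewrite /h' ii0.
    rewrite -[LHS]/(\int[P]_w (\1_(X i0 @^-1` B) w)%:E)%E integral_indic
      ?setIT//.
    exact: mX.
  + move=> i ki; rewrite /h'; case: eqP => [_|/eqP ii0]; first by exists B.
    by apply: hB; rewrite ltn_neqAle ki andbT; apply: contra ii0 => /eqP ik;
      apply/eqP/val_inj.
  + by move=> i; rewrite /h'; case: eqP => // _; exact: measurable_indic.
  + by move=> i x; rewrite /h'; case: eqP => // _; rewrite indicE.
- exact/measurable_EFinP.
rewrite /= ge0_integralZr//; last 2 first.
- apply/measurable_EFinP; exact: measurableT_comp.
- by move=> w _; rewrite lee_fin.
by rewrite (bigD1 i0).
Qed.

(** * Affinities, brackets and the tail bound over finitely many cells *)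

(** Let [x], [y], [z] be the roots of [a], [c], [r]. Then [sqrt (a + r) <= x + z], so the left side
    is at most [x^2 + y^2 + 2 z y], and [2 z y <= b z^2 + y^2 / b]. The free weight [b] balances the
    last two terms; it will be the sample size. *)
Lemma sqrt_affinity_le {R : rcfType} (a c r b : R) :
  0 <= a -> 0 <= c -> 0 <= r -> 0 < b ->
  2 * Num.sqrt ((a + r) * c) + (Num.sqrt a - Num.sqrt c) ^+ 2 <=
  a + c + (b * r + b^-1 * c).
Proof.
move=> a0 c0 r0 b0.
have sqr_sqrt u : 0 <= u -> exists2 v : R, 0 <= v & (u = v ^+ 2) /\ Num.sqrt u
  = v.
  by move=> u0; exists (Num.sqrt u); rewrite ?sqrtr_ge0// sqr_sqrtr.
rewrite sqrtrM ?addr_ge0//.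
have {a a0} [x x0 [-> ->]] := sqr_sqrt _ a0.
have {c c0} [y y0 [-> ->]] := sqr_sqrt _ c0.
have {r r0 sqr_sqrt} [z z0 [-> _]] := sqr_sqrt _ r0.
have xz : Num.sqrt (x ^+ 2 + z ^+ 2) <= x + z.
  rewrite -(@ler_pXn2r _ 2)// ?nnegrE ?sqrtr_ge0 ?addr_ge0//.
  rewrite sqr_sqrtr ?addr_ge0 ?sqr_ge0// sqrrD lerD2r lerDl.
  by rewrite mulrn_wge0// mulr_ge0.
have zy : 2 * (z * y) <= b * z ^+ 2 + b^-1 * y ^+ 2.
  rewrite -subr_ge0 (_ : _ - _ = b^-1 * (b * z - y) ^+ 2).
    by rewrite mulr_ge0 ?sqr_ge0// invr_ge0 ltW.
  by field; rewrite gt_eqF.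
have := ler_wpM2r y0 xz; nra.
Qed.

Section ge0_integral_real.
Context {d : measure_display} {T : measurableType d} {R : realType}.
Variable mu : {measure set T -> \bar R}.

Lemma ge0_integralZl_real (k : R) (f : T -> R) :
  0 <= k -> measurable_fun [set: T] f -> (forall x, 0 <= f x) ->
  (\int[mu]_x (k * f x)%:E = k%:E * \int[mu]_x (f x)%:E)%E.
Proof.
move=> k0 mf f0; under eq_integral do rewrite EFinM.
by rewrite ge0_integralZl_EFin//; [move=> x _;
  rewrite lee_fin|exact/measurable_EFinP].
Qed.

Lemma ge0_integralD_real (f g : T -> R) :
  measurable_fun [set: T] f -> (forall x, 0 <= f x) ->
  measurable_fun [set: T] g -> (forall x, 0 <= g x) ->
  (\int[mu]_x (f x + g x)%:E = \int[mu]_x (f x)%:E + \int[mu]_x (g x)%:E)%E.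
Proof.
move=> mf f0 mg g0; under eq_integral do rewrite EFinD.
by rewrite ge0_integralD//; [move=> x _; rewrite lee_fin|exact/measurable_EFinP|
  move=> x _; rewrite lee_fin|exact/measurable_EFinP].
Qed.

Lemma ge0_le_integral_real (f g : T -> R) :
  measurable_fun [set: T] f -> (forall x, 0 <= f x) ->
  measurable_fun [set: T] g -> (forall x, f x <= g x) ->
  (\int[mu]_x (f x)%:E <= \int[mu]_x (g x)%:E)%E.
Proof.
move=> mf f0 mg fg; apply: ge0_le_integral => //.
- by move=> x _; rewrite lee_fin.
- exact/measurable_EFinP.
- exact/measurable_EFinP.
- by move=> x _; rewrite lee_fin.
Qed.

End ge0_integral_real.

Lemma measurable_sqrt {R : realType} : measurable_fun [set: R] (@Num.sqrt R).
Proof. by apply: continuous_measurable_fun; exact: sqrt_continuous. Qed.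

Section bracketing.
Context {R : realType} (mu : {measure set R -> \bar R}).

Lemma measurable_sqrtM (f g : R -> R) :
  measurable_fun [set: R] f -> measurable_fun [set: R] g ->
  measurable_fun [set: R] (fun x => Num.sqrt (f x * g x)).
Proof.
move=> mf mg; apply: (measurableT_comp measurable_sqrt).
exact: measurable_funM.
Qed.

(** This is [sqrt_affinity_le] integrated against [mu], with [f] and [f0] of mass at most 1 and [r]
    of mass at most [rho]. *)
Lemma affinity_bracket_le (f f0 r : R -> R) (b rho s : R) :
  measurable_fun [set: R] f -> (forall x, 0 <= f x) ->
  (\int[mu]_x (f x)%:E <= 1)%E ->
  measurable_fun [set: R] f0 -> (forall x, 0 <= f0 x) ->
  (\int[mu]_x (f0 x)%:E <= 1)%E ->
  measurable_fun [set: R] r -> (forall x, 0 <= r x) ->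
  (\int[mu]_x (r x)%:E <= rho%:E)%E ->
  0 < b -> (s%:E <= hellinger2 mu f f0)%E ->
  (\int[mu]_x (Num.sqrt ((f x + r x) * f0 x))%:E <=
   (1 - s / 2 + (b * rho + b^-1) / 2)%:E)%E.
Proof.
move=> mf f_ge0 f1 mf0 f0_ge0 f01 mr r0 r1 b0 sH.
have mh : measurable_fun [set: R] (fun x => (Num.sqrt (f x) - Num.sqrt (f0 x))
  ^+ 2).
  by apply: measurable_funX; apply: measurable_funB;
    apply: (measurableT_comp measurable_sqrt).
have ms : measurable_fun [set: R] (fun x => Num.sqrt ((f x + r x) * f0 x)).
  by apply: measurable_sqrtM => //; exact: measurable_funD.
set I := (\int[mu]_x (Num.sqrt ((f x + r x) * f0 x))%:E)%E.
have I0 : (0 <= I)%E by apply: integral_ge0 => x _; rewrite lee_fin sqrtr_ge0.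
have bi0 : 0 <= b^-1 by rewrite invr_ge0 ltW.
have : (2%:E * I + hellinger2 mu f f0 <=
    \int[mu]_x (f x)%:E + \int[mu]_x (f0 x)%:E +
    (b%:E * \int[mu]_x (r x)%:E + b^-1%:E * \int[mu]_x (f0 x)%:E))%E.
  have br0 x : 0 <= b * r x by rewrite mulr_ge0 // ltW.
  have bf0 x : 0 <= b^-1 * f0 x by rewrite mulr_ge0.
  have mbr : measurable_fun [set: R] (fun x => b * r x) by exact:
    measurable_funM.
  have mbf : measurable_fun [set: R] (fun x => b^-1 * f0 x).
    exact: measurable_funM.
  have m2s : measurable_fun [set: R] (fun x => 2 * Num.sqrt ((f x + r x) * f0
    x)).
    exact: measurable_funM.
  rewrite /I /hellinger2 -!ge0_integralZl_real ?(ltW b0)//.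
  rewrite -!ge0_integralD_real//; last 5 first.
  - exact: measurable_funD.
  - by move=> x; exact: addr_ge0.
  - exact: measurable_funD.
  - by move=> x; exact: addr_ge0.
  - by move=> x; exact: sqr_ge0.
  apply: ge0_le_integral_real => //.
  - exact: measurable_funD.
  - by move=> x; rewrite addr_ge0 ?sqr_ge0// mulr_ge0// sqrtr_ge0.
  - by apply: measurable_funD; exact: measurable_funD.
  - by move=> x; exact: sqrt_affinity_le.
move=> /(le_trans (leeD2l _ sH)).
have ub : (\int[mu]_x (f x)%:E + \int[mu]_x (f0 x)%:E +
    (b%:E * \int[mu]_x (r x)%:E + b^-1%:E * \int[mu]_x (f0 x)%:E) <=
    (1 + 1 + (b * rho + b^-1 * 1))%:E)%E.
  rewrite !EFinD; apply: leeD; first exact: leeD.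
  by rewrite !EFinM; apply: leeD; apply: lee_wpmul2l => //; rewrite lee_fin ltW.
move=> /le_trans /(_ ub).
move: I I0 => [I| |]//= _; last by rewrite mulry/= gtr0_sg// mul1e addye.
by rewrite -EFinM -EFinD !lee_fin; lra.
Qed.

(* The test statistic is the square root of the likelihood ratio of the upper
   bracket [f + r] and [f0]; where [f0] vanishes, the division gives 0. *)
Lemma expectation_prod_bracket_le {d : measure_display} {T : measurableType d}
    (P : probability T R) n (X : 'I_n -> {RV P >-> R})
    (f f0 r : R -> R) (b rho s : R) :
  iid_density X mu f0 ->
  measurable_fun [set: R] f -> (forall x, 0 <= f x) ->
  (\int[mu]_x (f x)%:E <= 1)%E ->
  measurable_fun [set: R] f0 -> (forall x, 0 <= f0 x) ->
  (\int[mu]_x (f0 x)%:E <= 1)%E ->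
  measurable_fun [set: R] r -> (forall x, 0 <= r x) ->
  (\int[mu]_x (r x)%:E <= rho%:E)%E ->
  0 < b -> (s%:E <= hellinger2 mu f f0)%E ->
  (\int[P]_w (\prod_(i < n) Num.sqrt ((f (X i w) + r (X i w)) / f0 (X i w)))%:E
    <=
   (expR (n%:R * (- (s / 2) + (b * rho + b^-1) / 2)))%:E)%E.
Proof.
move=> [indX lawX] mf f_ge0 f1 mf0 f0_ge0 f01 mr r0 r1 b0 sH.
(* The quotient is written with the power -1 so that measurability follows from that of powers. *)
pose phi x := Num.sqrt ((f x + r x) * f0 x `^ (-1)).
have mphi : measurable_fun [set: R] phi.
  apply: measurable_sqrtM; first exact: measurable_funD.
  exact: (measurableT_comp (measurable_powR (-1))).
under eq_integral => w _.
  rewrite (eq_bigr (fun i => phi (X i w))) => [|i _];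
    last by rewrite /phi powR_inv1.
  over.
rewrite (integral_prod_independent (h := fun=> phi))//; last first.
  by move=> _ x; exact: sqrtr_ge0.
have E i : (\int[P]_w (phi (X i w))%:E =
    \int[mu]_x (Num.sqrt ((f x + r x) * f0 x))%:E)%E.
  transitivity (\int[P]_w ((EFin \o phi) (X i w) * cst 1 w))%E.
    by apply: eq_integral => w _; rewrite mule1.
  rewrite (@eq_integral_weight _ _ _ _ _ _ _ P mu (X i) id (cst 1%E)
    (EFin \o f0) (EFin \o phi))//; first last.
  - by move=> x; rewrite lee_fin sqrtr_ge0.
  - exact/measurable_EFinP.
  - move=> B mB; rewrite -(lawX i)// integral_cst ?mul1e//.
    exact: measurable_funPTI.
  - exact/measurable_EFinP.
  apply: eq_integral => x _; rewrite /= -EFinM; congr EFin;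
    rewrite /phi powR_inv1//.
  have [->|f0x] := eqVneq (f0 x) 0; first by rewrite !mulr0 sqrtr0.
  rewrite -[X in _ * X]ger0_norm// -sqrtr_sqr -sqrtrM; last first.
    by rewrite divr_ge0// addr_ge0.
  by congr (Num.sqrt _); field.
rewrite (eq_bigr _ (fun i _ => E i)) expRM_natl.
have := affinity_bracket_le mf f_ge0 f1 mf0 f0_ge0 f01 mr r0 r1 b0 sH.
have : (0 <= \int[mu]_x (Num.sqrt ((f x + r x) * f0 x))%:E)%E.
  by apply: integral_ge0 => x _; rewrite lee_fin sqrtr_ge0.
case: (\int[mu]_x _)%E => [v| |]//; rewrite !lee_fin => v0 vle.
rewrite prodEFin lee_fin prodr_const card_ord lerXn2r ?nnegrE ?expR_ge0//.
apply: le_trans vle _; apply: le_trans (expR_ge1Dx _); lra.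
Qed.

(** The law of each observation gives the zero set of [f0] the integral of [f0] over that set, which
    is 0. *)
Lemma ae_sample_density_gt0 {d : measure_display} {T : measurableType d}
    (P : probability T R) n (X : 'I_n -> {RV P >-> R}) (f0 : R -> R) :
  iid_density X mu f0 -> measurable_fun [set: R] f0 -> (forall x, 0 <= f0 x) ->
  \forall w \ae P, forall i, 0 < f0 (X i w).
Proof.
move=> [_ lawX] mf0 f0_ge0; apply: filter_forall => i.
have mB : measurable (f0 @^-1` [set 0]).
  by rewrite -[X in measurable X]setTI; exact: mf0.
exists (X i @^-1` (f0 @^-1` [set 0])); split.
- exact: measurable_funPTI.
- rewrite -[LHS]/(distribution P (X i) _) lawX// integral0_eq// => x fx0.
  by congr EFin.
- move=> w /negP; rewrite -leNgt => f0le; apply/eqP.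
  by rewrite eq_le f0le f0_ge0.
Qed.

(** The random index [gam w] is replaced by a fixed representative of its cell, at the price of the
    bracket width [r]. Only finitely many fixed statistics remain, and each has a controlled
    expectation. *)
Lemma bracketing_tail {d : measure_display} {T : measurableType d}
    (P : probability T R) n (X : 'I_n -> {RV P >-> R}) (G : Type) (J : finType)
    (f : G -> R -> R) (cell : G -> J) (f0 r : R -> R) (b rho s a : R)
    (S : set T) (gam : T -> G) :
  iid_density X mu f0 ->
  (forall g, measurable_fun [set: R] (f g)) -> (forall g x, 0 <= f g x) ->
  (forall g, \int[mu]_x (f g x)%:E <= 1)%E ->
  measurable_fun [set: R] f0 -> (forall x, 0 <= f0 x) ->
  (\int[mu]_x (f0 x)%:E <= 1)%E ->
  measurable_fun [set: R] r -> (forall x, 0 <= r x) ->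
  (\int[mu]_x (r x)%:E <= rho%:E)%E -> 0 < b ->
  (forall g h, cell g = cell h -> forall x, f g x <= f h x + r x) ->
  measurable S ->
  (forall w, S w -> (s%:E <= hellinger2 mu (f (gam w)) f0)%E) ->
  (\forall w \ae P, S w ->
     expR (- a) * \prod_(i < n) f0 (X i w) <= \prod_(i < n) f (gam w) (X i w))
       ->
  (P S <= (#|J|%:R * expR (a / 2 + n%:R * (- (s / 2) + (b * rho + b^-1) /
    2)))%:E)%E.
Proof.
move=> iidX mf f_ge0 f1 mf0 f0_ge0 f01 mr r0 r1 b0 fcell mS SH Sae.
(* [far j] is a member of cell [j] at squared distance at least [s] from [f0], if there is one; on
   [S] the cell of [gam w] has one, namely [gam w]. *)
have /choice[far nfar] : forall j, exists o : option G, match o with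
    | Some g => cell g = j /\ (s%:E <= hellinger2 mu (f g) f0)%E
    | None => forall g, cell g = j -> ~ (s%:E <= hellinger2 mu (f g) f0)%E end.
  move=> j; have [[g gj]|ng] := pselect (exists g, cell g = j /\
    (s%:E <= hellinger2 mu (f g) f0)%E); first by exists (Some g).
  by exists None => g gj gH; apply: ng; exists g.
pose lr g w := \prod_(i < n) Num.sqrt ((f g (X i w) + r (X i w)) / f0 (X i w)).
have mlr g : measurable_fun [set: T] (lr g).
  apply: measurable_prod => i _.
  pose phi x := Num.sqrt ((f g x + r x) * f0 x `^ (-1)).
  rewrite (_ : (fun=> _) = phi \o X i); last first.
    by apply/funext => w /=; rewrite /phi powR_inv1.
  apply: measurableT_comp => //; apply: measurable_sqrtM.
    exact: measurable_funD.
  exact: (measurableT_comp (measurable_powR (-1))).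
have lr0 g w : 0 <= lr g w by rewrite prodr_ge0// => i _; exact: sqrtr_ge0.
(* The factor [expR (a / 2)] makes the statistic of the cell of [gam w] at least 1 almost surely on
   [S]. *)
pose stat j w := if far j is Some g then expR (a / 2) * lr g w else 0.
have mstat j : measurable_fun [set: T] (stat j).
  rewrite /stat; case: (far j) => [g|]; last exact: measurable_cst.
  exact: measurable_funM.
have stat0 j w : 0 <= stat j w.
  rewrite /stat; case: (far j) => // g; rewrite mulr_ge0 ?expR_ge0//.
have int_stat j : (\int[P]_w (stat j w)%:E <=
    (expR (a / 2 + n%:R * (- (s / 2) + (b * rho + b^-1) / 2)))%:E)%E.
  rewrite /stat; case: (far j) (nfar j) => [g [_ gH]|_]; last first.
    by rewrite integral0_eq// lee_fin expR_ge0.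
  rewrite ge0_integralZl_real ?expR_ge0// expRD EFinM.
  rewrite lee_wpmul2l// ?lee_fin ?expR_ge0//.
  exact: expectation_prod_bracket_le.
rewrite -[in leLHS](setIT S) -integral_indic//.
(* Markov's inequality and the union bound in one step: the indicator of [S] is almost surely at
   most the sum of all statistics. *)
apply: (@le_trans _ _ (\int[P]_w (\sum_j (stat j w)%:E))%E).
  apply: ae_ge0_le_integral => //.
  - exact/measurable_EFinP/measurable_indic.
  - by move=> w _; apply: sume_ge0 => j _; rewrite lee_fin.
  - by apply: emeasurable_sum => j; exact/measurable_EFinP.
  apply: filterS2 (ae_sample_density_gt0 iidX mf0 f0_ge0) Sae => w f0w Sw _.
  rewrite indicE; case: (boolP (w \in S)) => [/set_mem wS|_]; last first.
    by apply: sume_ge0 => j _; rewrite lee_fin.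
  move: Sw => /(_ wS) Sw.
  rewrite (bigD1 (cell (gam w)))//= -[leLHS]adde0; apply: leeD; last first.
    by apply: sume_ge0 => j _; rewrite lee_fin.
  rewrite lee_fin /stat; case: (far _) (nfar (cell (gam w))) => [g [gw _]|];
    last first.
    by move=> /(_ _ erefl); case; exact: SH.
  (* Squaring removes the roots; what remains is the likelihood hypothesis followed by
     [f (gam w) <= f g + r] within the cell. *)
  rewrite -(@ler_pXn2r _ 2)// ?nnegrE ?mulr_ge0 ?expR_ge0// expr1n exprMn.
  have -> : expR (a / 2) ^+ 2 = expR a by rewrite -expRM_natl mulrC divfK.
  rewrite /lr -prodrXl.
  under eq_bigr do rewrite sqr_sqrtr ?divr_ge0 ?addr_ge0//.
  rewrite prodf_div mulrA ler_pdivlMr; last by rewrite prodr_gt0.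
  rewrite mul1r -ler_pdivrMl ?expR_gt0// -expRN; apply: le_trans Sw _.
  by apply: ler_prod => i _; rewrite f_ge0 fcell.
rewrite ge0_integral_sum//; last 2 first.
- by move=> j; exact/measurable_EFinP.
- by move=> j w _; rewrite lee_fin.
apply: (le_trans (lee_sum _ (fun j _ => int_stat j))).
by rewrite sumEFin lee_fin sumr_const (mulr_natl (expR _)).
Qed.

End bracketing.

(** * Measures with densities, and supports of mixing distributions *)

(** Absorbing [p0] into the base measure turns the arbitrary measure [mu] into a probability, for
    which Tonelli's theorem holds. *)
Lemma exists_probability_density {d : measure_display} {T : measurableType d}
    {R : realType} (mu : {measure set T -> \bar R}) (w : T -> R) :
  measurable_fun [set: T] w -> (forall x, 0 <= w x) ->
  (\int[mu]_x (w x)%:E = 1)%E ->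
  exists nu : probability T R, forall B, measurable B ->
    nu B = (\int[mu]_(x in B) (w x)%:E)%E.
Proof.
move=> mw w0 w1.
pose m B := (\int[mu]_(x in B) (w x)%:E)%E.
have m0 : m set0 = 0%E by exact: integral_set0.
have m_ge0 B : (0 <= m B)%E by apply: integral_ge0 => x _; rewrite lee_fin.
have m_add : semi_sigma_additive m.
  move=> F mF tF mUF; rewrite /m ge0_integral_bigcup//; last 2 first.
  - by apply/measurable_EFinP; exact: measurable_funTS.
  - by move=> x _; rewrite lee_fin.
  by apply: is_cvg_ereal_nneg_natsum_cond => k _ _; exact: m_ge0.
pose mm := isMeasure.Build _ _ _ m m0 m_ge0 m_add.
pose m1 : {measure set T -> \bar R} := HB.pack m mm.
pose mp := Measure_isProbability.Build _ _ _ m1 w1.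
pose m2 : probability T R := HB.pack m mm mp.
by exists m2.
Qed.

Section mixing.
Context {R : realType}.

Lemma open_rat_itv (U : set R) (x : R) : open U -> U x ->
  exists p q : rat, (ratr p < x < ratr q) /\ `]ratr p, ratr q[ `<=` U.
Proof.
move=> oU Ux; have /nbhs_ballP[e /= e0 eU] := open_nbhs_nbhs (conj oU Ux).
have [|p] := @rat_in_itvoo R (x - e) x; first by rewrite ltrBlDr ltrDl.
have [|q] := @rat_in_itvoo R x (x + e); first by rewrite ltrDl.
rewrite !in_itv/= => /andP[xq qe] /andP[ep px].
exists p, q; rewrite px xq; split => // y /=; rewrite in_itv/= => /andP[py yq].
by apply: eU; rewrite /ball/= ltr_distlC; apply/andP; split; lra.
Qed.

(* The rational intervals of measure 0 form a countable cover of the complement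
   of the support. *)
Lemma negligible_setC_msupport (g : probability R R) :
  g.-negligible (~` msupport g).
Proof.
pose F n := if unpickle n is Some (p, q) then
  if g `]ratr p, ratr q[%classic == 0%E then `]ratr p, ratr q[%classic else set0
  else set0 : set R.
apply: (@negligibleS _ _ _ _ (\bigcup_n F n)); last first.
  apply: negligible_bigcup => n; rewrite /F.
  case: unpickle => [[p q]|]; last exact: negligible_set0.
  case: ifPn => [/eqP g0|_]; last exact: negligible_set0.
  by apply/negligibleP.
move=> x /existsNP[U /not_implyP[oU /not_implyP[Ux /negP]]].
rewrite -leNgt => gU.
have [p [q [pxq pqU]]] := open_rat_itv oU Ux.
have {}gU : g `]ratr p, ratr q[%classic == 0%E.
  rewrite eq_le measure_ge0 andbT; apply: le_trans gU.
  by rewrite le_measure// inE//; exact: open_measurable.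
exists (pickle (p, q)); first exact: I.
by rewrite /F pickleK gU; rewrite /= in_itv.
Qed.

Lemma measurable_param_space (M : R) : measurable (param_space M).
Proof.
have -> : param_space M = `[- M, M]%classic.
  by apply/seteqP; split => x /=; rewrite in_itv/= /param_space/= ler_norml.
exact: measurable_itv.
Qed.

Lemma mixing_ae_param_space (M : R) (g : probability R R) :
  mixing M g -> \forall t \ae g, param_space M t.
Proof.
by move=> gM; apply: negligibleS (negligible_setC_msupport g); exact: subsetC.
Qed.

End mixing.

(** * The Taylor remainder of the exponential, and integrals of bounded functions *)

Section expR_taylor.
Context {R : realType}.

Lemma sum_exp_coeff_le (x : R) K : 0 <= x ->
  \sum_(0 <= k < K) x ^+ k / k`!%:R <= expR x.
Proof.
move=> x0; apply: (nondecreasing_cvgn_le _ (is_cvg_series_exp_coeff x)).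
by apply: nondecreasing_series => n _ _; exact: exp_coeff_ge0.
Qed.

(** For [k >= K] one has [|x|^k = rho^k (|x| / rho)^k <= rho^K (|x| / rho)^k], and the sum of the
    [(|x| / rho)^k / k!] is at most [exp (|x| / rho)]. *)
Lemma expR_taylor_le (x rho : R) K : 0 < rho -> rho <= 1 ->
  `|expR x - \sum_(0 <= k < K) x ^+ k / k`!%:R| <= rho ^+ K * expR (`|x| / rho).
Proof.
move=> rho0 rho1.
have c : `|series (exp_coeff x) n - \sum_(0 <= k < K) x ^+ k / k`!%:R| @[n -->
  \oo]
    --> `|expR x - \sum_(0 <= k < K) x ^+ k / k`!%:R|.
  apply: cvg_norm; apply: cvgB; last exact: cvg_cst.
  exact: is_cvg_series_exp_coeff.
apply: (cvgr_to_le c); exists K => // n /= Kn.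
rewrite /series/= (big_cat_nat (leq0n K) Kn)//= addrAC subrr add0r.
apply: le_trans (ler_norm_sum _ _ _) _.
apply: (@le_trans _ _ (rho ^+ K * \sum_(K <= k < n) (`|x| / rho) ^+ k /
  k`!%:R)).
  rewrite mulr_sumr big_nat [leRHS]big_nat; apply: ler_sum => k /andP[Kk _].
  rewrite /exp_coeff/= normrM normrX [`|_^-1|]ger0_norm ?invr_ge0//.
  rewrite mulrA ler_wpM2r ?invr_ge0// exprMn mulrCA ler_peMr ?exprn_ge0//.
  rewrite -(subnK Kk) exprD mulrCA -exprMn divff ?gt_eqF// expr1n mulr1.
  by rewrite exprVn invf_ge1 ?exprn_gt0// exprn_ile1// ltW.
rewrite ler_wpM2l ?exprn_ge0 ?(ltW rho0)//.
apply: le_trans (sum_exp_coeff_le n _); last by rewrite divr_ge0// ltW.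
rewrite [leRHS](big_cat_nat (leq0n K) Kn)//= lerDr sumr_ge0// => k _.
by rewrite divr_ge0// exprn_ge0// divr_ge0// ltW.
Qed.

End expR_taylor.

Lemma integrable_le_bound {d : measure_display} {T : measurableType d}
    {R : realType} (g : probability T R) (f : T -> R) (B : R) :
  measurable_fun [set: T] f -> (forall t, `|f t| <= B) ->
  g.-integrable [set: T] (EFin \o f).
Proof.
move=> mf fB; apply: measurable_bounded_integrable => //.
  by apply: (le_lt_trans (probability_le1 g measurableT)); exact: ltry.
exists B; split; first exact: num_real.
by move=> C BC t _ /=; apply: le_trans (fB t) (ltW BC).
Qed.

Lemma normr_Rintegral_le_bound {d : measure_display} {T : measurableType d}
    {R : realType} (g : probability T R) (f : T -> R) (B : R) :
  measurable_fun [set: T] f -> (forall t, `|f t| <= B) ->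
  `|\int[g]_t f t| <= B.
Proof.
move=> mf fB; have intf := integrable_le_bound g mf fB.
apply: le_trans (le_normr_Rintegral measurableT intf) _.
apply: (@le_trans _ _ (\int[g]_t (cst B t))).
  apply: le_Rintegral => //.
  - apply: (@integrable_le_bound _ _ _ g _ B); first exact: measurableT_comp.
    by move=> t; rewrite normr_id.
  - apply: (@integrable_le_bound _ _ _ g _ `|B|); first exact: measurable_cst.
    by move=> t.
have gT : g [set: T] = 1%E by exact: probability_setT.
by rewrite Rintegral_cst// [fine _](congr1 fine gT) mulr1.
Qed.

(** * Mixtures of exponentials with a bounded weight, and their moments *)

Section exponential_mixture.
Context {R : realType} (nu : probability R R) (W : R -> R) (M E : R).
Hypothesis M0 : 0 < M.
Hypothesis mW : measurable_fun [set: R] W.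
Hypothesis W0 : forall t, 0 <= W t.
Hypothesis WE : forall t, W t <= E.
Hypothesis Wout : forall t, ~ param_space M t -> W t = 0.
Hypothesis Wnu : forall t, ((W t)%:E * \int[nu]_x (expR (t * x))%:E <= 1)%E.

Implicit Types (g h : probability R R) (t x : R).

Let E0 : 0 <= E. Proof. exact: le_trans (W0 0) (WE 0). Qed.

(** The factor [q_g] of a mixture density relative to [p0]; [W] stands for the truncated normalizing
    factor. *)
Definition exp_mixture (g : probability R R) (x : R) : R :=
  \int[g]_t (expR (t * x) * W t).

(** Dividing by [M] keeps the moments of all orders in the same interval [[-E, E]]. *)
Definition scaled_moment (k : nat) (g : probability R R) : R :=
  \int[g]_t ((t / M) ^+ k * W t).

Lemma weight_mul_le (a : R -> R) (B : R) :
  (forall t, param_space M t -> `|a t| <= B) -> 0 <= B ->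
  forall t, `|a t * W t| <= B * E.
Proof.
move=> aB B0 t; have [tM|tM] := pselect (param_space M t).
  by rewrite normrM ler_pM// ?aB// ger0_norm.
by rewrite (Wout tM) mulr0 normr0 mulr_ge0.
Qed.

Lemma measurable_expRM (x : R) : measurable_fun [set: R] (fun t => expR (t *
  x)).
Proof. by apply: (measurableT_comp (@measurable_expR R));
  exact: measurable_funM. Qed.

Lemma param_space_mul_le (t x : R) : param_space M t -> `|t * x| <= M * `|x|.
Proof. by move=> tM; rewrite normrM ler_wpM2r. Qed.

Lemma integrable_exp_weight (g : probability R R) x :
  g.-integrable [set: R] (fun t => (expR (t * x) * W t)%:E).
Proof.
apply: (@integrable_le_bound _ _ _ g _ (expR (M * `|x|) * E)).
  by apply: measurable_funM => //; exact: measurable_expRM.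
apply: weight_mul_le => [t tM|]; last exact: expR_ge0.
rewrite ger0_norm ?expR_ge0// ler_expR.
by rewrite (le_trans (ler_norm _))// param_space_mul_le.
Qed.

Lemma integrable_moment (g : probability R R) k :
  g.-integrable [set: R] (fun t => ((t / M) ^+ k * W t)%:E).
Proof.
apply: (@integrable_le_bound _ _ _ g _ (1 * E)).
  apply: measurable_funM => //; apply: measurable_funX.
  exact: measurable_funM.
apply: weight_mul_le => // t tM.
by rewrite normrX exprn_ile1// normrM normfV (gtr0_norm M0) ler_pdivrMr// mul1r.
Qed.

Lemma measurable_exp_weight :
  measurable_fun [set: R * R] (fun z => (expR (z.2 * z.1) * W z.2)%:E).
Proof.
apply/measurable_EFinP; apply: measurable_funM.
  by apply: (measurableT_comp (@measurable_expR R)); exact: measurable_funM.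
exact: measurableT_comp.
Qed.

Lemma exp_mixture_ge0 g x : 0 <= exp_mixture g x.
Proof. by apply: Rintegral_ge0 => t _; rewrite mulr_ge0 ?expR_ge0. Qed.

Lemma EFin_exp_mixture g x :
  ((exp_mixture g x)%:E = \int[g]_t (expR (t * x) * W t)%:E)%E.
Proof.
rewrite /exp_mixture /Rintegral fineK//.
exact: integrable_fin_num (integrable_exp_weight _ _).
Qed.

Lemma measurable_exp_mixture g : measurable_fun [set: R] (exp_mixture g).
Proof.
apply/measurable_EFinP; rewrite (_ : EFin \o _ = fubini_F g
   (fun z : R * R => (expR (z.2 * z.1) * W z.2)%:E)); last first.
  by apply/funext => x /=; rewrite EFin_exp_mixture.
apply: measurable_fun_fubini_tonelli_F; first exact: measurable_exp_weight.
by move=> z; rewrite lee_fin mulr_ge0 ?expR_ge0.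
Qed.

(** Tonelli's theorem exchanges the integrals and [Wnu] bounds the inner one. The mass can be less
    than 1, since [g] is arbitrary and [W] vanishes off the parameter space. *)
Lemma integral_exp_mixture_le1 g : (\int[nu]_x (exp_mixture g x)%:E <= 1)%E.
Proof.
under eq_integral do rewrite EFin_exp_mixture.
rewrite (@fubini_tonelli _ _ _ _ _ nu g
  (fun z : R * R => (expR (z.2 * z.1) * W z.2)%:E)); last 2 first.
- exact: measurable_exp_weight.
- by move=> z; rewrite lee_fin mulr_ge0 ?expR_ge0.
apply: (@le_trans _ _ (\int[g]_t (cst 1 t))%E); last first.
  by rewrite integral_cst// mul1e; exact: probability_le1.
apply: ge0_le_integral => //.
- by move=> t _; apply: integral_ge0 => x _; rewrite lee_fin mulr_ge0 ?expR_ge0.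
- apply: (@measurable_fun_fubini_tonelli_G _ _ _ _ _ nu
    (fun z : R * R => (expR (z.2 * z.1) * W z.2)%:E)).
    exact: measurable_exp_weight.
  by move=> z; rewrite lee_fin mulr_ge0 ?expR_ge0.
- move=> t _ /=; apply: le_trans (Wnu t).
  rewrite -ge0_integralZl_real//; first by under eq_integral do rewrite mulrC.
  exact: (measurableT_comp (@measurable_expR R) (measurable_funM _ _)).
Qed.

(** Integrability is carried through the induction because additivity of the integral asks for it;
    the terms match by [(t x)^k = (M x)^k (t / M)^k]. *)
Lemma Rintegral_taylor g (x : R) K :
  g.-integrable [set: R] (EFin \o (fun t =>
     (\sum_(0 <= k < K) (t * x) ^+ k / k`!%:R) * W t)) /\
  \int[g]_t ((\sum_(0 <= k < K) (t * x) ^+ k / k`!%:R) * W t) =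
  \sum_(0 <= k < K) ((M * x) ^+ k / k`!%:R) * scaled_moment k g.
Proof.
have i_term k : g.-integrable [set: R]
    (EFin \o fun t => ((M * x) ^+ k / k`!%:R) * ((t / M) ^+ k * W t)).
  by apply: (eq_integrable _ (fun t => ((M * x) ^+ k / k`!%:R)%:E *
    ((t / M) ^+ k * W t)%:E)%E) => //;
      exact: integrableZl (integrable_moment _ _).
have termE k t : ((M * x) ^+ k / k`!%:R) * ((t / M) ^+ k * W t) =
    (t * x) ^+ k / k`!%:R * W t.
  rewrite !mulrA; congr (_ * _); rewrite mulrAC; congr (_ / _).
  by rewrite -exprMn; congr (_ ^+ _); field; rewrite gt_eqF.
elim: K => [|K [IHi IH]].
  rewrite (_ : (fun t => _) = cst 0); last first.
    by apply/funext => t; rewrite big_geq// mul0r.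
  split; first exact: integrable0.
  by rewrite big_geq// /Rintegral integral0.
have sE : (fun t => (\sum_(0 <= k < K.+1) (t * x) ^+ k / k`!%:R) * W t) =
    (fun t => (\sum_(0 <= k < K) (t * x) ^+ k / k`!%:R) * W t +
       ((M * x) ^+ K / K`!%:R) * ((t / M) ^+ K * W t)).
  by apply/funext => t; rewrite big_nat_recr//= mulrDl termE.
rewrite sE; split.
  exact: (integrableD measurableT IHi (i_term K)).
rewrite RintegralD// IH big_nat_recr//=; congr (_ + _).
by rewrite RintegralZl//; exact: integrable_moment.
Qed.

Lemma exp_mixture_taylor_le g x (rho : R) K : 0 < rho -> rho <= 1 ->
  `|exp_mixture g x - \sum_(0 <= k < K) ((M * x) ^+ k / k`!%:R) * scaled_moment
    k g|
  <= rho ^+ K * expR (M * `|x| / rho) * E.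
Proof.
move=> rho0 rho1; have [isum <-] := Rintegral_taylor g x K.
rewrite /exp_mixture -RintegralB//; last exact: integrable_exp_weight.
apply: normr_Rintegral_le_bound.
  apply: measurable_funB; last first.
    by apply/measurable_EFinP; exact: measurable_int isum.
  by apply: measurable_funM => //; exact: measurable_expRM.
move=> t; rewrite -mulrBl; move: t; apply: weight_mul_le; last first.
  by rewrite mulr_ge0 ?expR_ge0// exprn_ge0// ltW.
move=> t tM; apply: le_trans (expR_taylor_le _ _ rho0 rho1) _.
rewrite ler_wpM2l ?exprn_ge0 ?(ltW rho0)// ler_expR ler_wpM2r ?invr_ge0 ?(ltW
  rho0)//.
exact: param_space_mul_le.
Qed.

Lemma normr_scaled_moment_le k g : `|scaled_moment k g| <= E.
Proof.
apply: normr_Rintegral_le_bound.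
  apply: measurable_funM => //; apply: measurable_funX.
  exact: measurable_funM.
move=> t; rewrite -[leRHS]mul1r; move: t; apply: weight_mul_le => // t tM.
by rewrite normrX exprn_ile1// normrM normfV (gtr0_norm M0) ler_pdivrMr// mul1r.
Qed.

(** Both mixtures are compared with their Taylor sums. The remainders cost
    [E rho^K exp (M |x| / rho)] each, and the moment differences cost [del exp (M |x|)], where the
    exponent only grows when divided by [rho]. *)
Lemma exp_mixture_sub_le g h x (rho del : R) K :
  0 < rho -> rho <= 1 -> 0 <= del ->
  (forall k, (k < K)%N -> `|scaled_moment k g - scaled_moment k h| <= del) ->
  exp_mixture g x <=
  exp_mixture h x + (del + 2 * E * rho ^+ K) * expR (M * `|x| / rho).
Proof.
move=> rho0 rho1 del0 gh.
have := exp_mixture_taylor_le g x K rho0 rho1.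
have := exp_mixture_taylor_le h x K rho0 rho1.
set Sg := \sum_(_ <= _ < _) _; set Sh := \sum_(_ <= _ < _) _.
have SD : Sh - Sg <= del * expR (M * `|x| / rho).
  rewrite -sumrB; apply: le_trans (ler_norm _) _;
    apply: le_trans (ler_norm_sum _ _ _) _.
  apply: (@le_trans _ _ (del * \sum_(0 <= k < K) (M * `|x|) ^+ k / k`!%:R)).
    rewrite mulr_sumr big_nat [leRHS]big_nat; apply: ler_sum => k /andP[_ kK].
    rewrite -mulrBr normrM mulrC ler_pM// ?gh//.
    by rewrite normrM normrX normfV normrM (gtr0_norm M0) [`|_%:R|]ger0_norm.
  rewrite ler_wpM2l//; apply: le_trans (sum_exp_coeff_le _ _) _.
    by rewrite mulr_ge0// ltW.
  rewrite ler_expR ler_pdivlMr// ler_piMr// mulr_ge0//; exact: ltW.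
rewrite !ler_norml => /andP[h1 h2] /andP[g1 g2].
have -> : (del + 2 * E * rho ^+ K) * expR (M * `|x| / rho) =
  del * expR (M * `|x| / rho) + 2 * (rho ^+ K * expR (M * `|x| / rho) * E).
  by ring.
lra.
Qed.

(** The cell of [g] records in which interval of length [del], counted from [-E], each of the first
    [K] moments lies. Moments are at most [E], so no index exceeds [2 E / del]. *)
Lemma exp_mixture_cells (rho del : R) (K N : nat) :
  0 < rho -> rho <= 1 -> 0 < del -> 2 * E / del <= N%:R ->
  exists cell : probability R R -> {ffun 'I_K -> 'I_N.+1},
    forall g h, cell g = cell h -> forall x,
    exp_mixture g x <=
    exp_mixture h x + (del + 2 * E * rho ^+ K) * expR (M * `|x| / rho).
Proof.
move=> rho0 rho1 del0 EN.
pose idx k g := Num.truncn ((scaled_moment k g + E) / del).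
have pos k g : 0 <= (scaled_moment k g + E) / del.
  have := normr_scaled_moment_le k g; rewrite ler_norml => /andP[gE _].
  by rewrite divr_ge0 ?(ltW del0)//; lra.
have idxN k g : (idx k g < N.+1)%N.
  rewrite ltnS -(@ler_nat R); apply: le_trans EN.
  have /andP[le_idx _] := truncn_itv (pos k g); apply: le_trans le_idx _.
  have := normr_scaled_moment_le k g; rewrite ler_norml => /andP[_ gE].
  by rewrite ler_pM2r ?invr_gt0//; lra.
exists (fun g => [ffun k : 'I_K => Ordinal (idxN k g)]) => g h /ffunP gh x.
apply: exp_mixture_sub_le => // [|k kK]; first exact: ltW.
have := gh (Ordinal kK); rewrite !ffunE => /(congr1 val)/= ik.
have /andP[g1 g2] := truncn_itv (pos k g).
have /andP[h1 h2] := truncn_itv (pos k h).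
move: g1 g2 h1 h2; rewrite -/(idx k g) -/(idx k h) ik.
rewrite !ler_pdivlMr// !ltr_pdivrMr// -natr1 => g1 g2 h1 h2.
by rewrite ler_norml; apply/andP; split; lra.
Qed.

End exponential_mixture.

(** * The size of the moment grid and the final exponent *)

(** Rounding up costs at most a factor 2 in the power of 2, so [2 ^ up_log 2 n <= 2 n <= n ^ 2]. *)
Lemma le_up_log2 {R : realType} (n : nat) : (2 <= n)%N ->
  (up_log 2 n)%:R * ln 2 <= 2 * ln n%:R :> R.
Proof.
move=> n2; have n0 : (0 < n)%N by exact: leq_trans n2.
have u0 : (0 < up_log 2 n)%N by rewrite up_log_gt0.
have h : (2 ^ up_log 2 n <= n ^ 2)%N.
  rewrite -(prednK u0) expnS leq_mul// ltnW//.
  exact: up_log_gtn.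
rewrite !mulr_natl -!lnXn ?ltr0n// ler_ln ?posrE ?exprn_gt0 ?ltr0n//.
by rewrite -!natrX ler_nat.
Qed.

(* [rho ^ K <= n^-2] already for [K] of order [ln n], so [K] moments rounded to
   [N] of order [n^2] values give [exp (O (ln n ^ 2))] cells. *)
Lemma exists_moment_grid {R : realType} (rho E : R) :
  0 < rho -> rho < 1 -> 0 <= E ->
  exists2 c : R, 0 < c & forall n : nat, (2 <= n)%N ->
    exists K N : nat, [/\ rho ^+ K <= (n%:R ^+ 2)^-1,
      E * n%:R ^+ 2 <= N%:R &
      (N.+1 ^ K)%:R <= expR (c * ln n%:R ^+ 2)].
Proof.
move=> rho0 rho1 E0.
have ln2 : 0 < ln 2 :> R by rewrite ln_gt0 ?ltr1n.
(* With [K = k0 * up_log 2 n] this gives [rho^K <= 4^(- up_log 2 n) <= n^-2]. *)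
have [k0 hk0] : exists k0, rho ^+ k0 <= 4^-1.
  have cv : rho ^+ k @[k --> \oo] --> (0 : R).
    by apply: cvg_expr; rewrite gtr0_norm.
  have [|k _ kP] := cvgr_lt _ cv 4^-1; first by rewrite invr_gt0.
  by exists k; exact/ltW/(kP k (leqnn k)).
pose D := (Num.truncn E).+1.
have ED : E <= D%:R by rewrite ltW// truncnS_gt.
(* Chosen so that [(D + 1) n^2 <= n^b] for all [n >= 2]; the number of grid values is at most the
   left side. *)
pose b : R := ln D.+1%:R / ln 2 + 2.
have b0 : 0 <= b by rewrite addr_ge0// divr_ge0 ?ln_ge0 ?ler1n// ltW.
exists (k0%:R * (2 / ln 2) * b + 1).
  by rewrite ltr_wpDl// !mulr_ge0 ?invr_ge0// ltW.
move=> n n2; have n0 : (0 < n)%N by exact: leq_trans n2.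
have L2 : ln 2 <= ln n%:R :> R by rewrite ler_ln ?posrE ?ltr0n ?ler_nat.
have L0 : 0 <= ln n%:R :> R by rewrite (le_trans _ L2) ?ltW.
exists (k0 * up_log 2 n)%N, (D * n ^ 2)%N; split.
- rewrite exprM (le_trans (_ : _ <= (4^-1) ^+ up_log 2 n))//.
    by rewrite lerXn2r ?nnegrE ?exprn_ge0 ?invr_ge0// ltW.
  rewrite exprVn lef_pV2 ?posrE ?exprn_gt0 ?ltr0n// -!natrX ler_nat.
  by rewrite -(expnM 2 2) mulnC expnM leq_exp2r// up_logP.
- by rewrite natrM natrX ler_wpM2r// exprn_ge0.
have N1 : (D * n ^ 2).+1%:R <= expR (b * ln n%:R).
  apply: (@le_trans _ _ (D.+1%:R * n%:R ^+ 2)).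
    rewrite -natrX -natrM ler_nat mulSn addnC -addn1 leq_add2l.
    by rewrite expn_gt0 n0.
  rewrite /b (mulrDl (ln D.+1%:R / ln 2)) expRD ler_pM ?exprn_ge0//.
    rewrite -[leLHS]lnK ?posrE// ler_expR -mulrA ler_peMr ?ln_ge0 ?ler1n//.
    by rewrite mulrC ler_pdivlMr// mul1r.
  by rewrite expRM_natl lnK// posrE ltr0n.
rewrite natrX; apply: le_trans (lerXn2r _ _ _ N1) _;
  rewrite ?nnegrE ?expR_ge0//.
rewrite -expRM_natl ler_expR natrM.
apply: (@le_trans _ _ (k0%:R * (2 / ln 2 * ln n%:R) * (b * ln n%:R))).
  rewrite ler_wpM2r ?mulr_ge0// ler_wpM2l// mulrAC ler_pdivlMr//.
  exact: le_up_log2.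
rewrite -subr_ge0 (_ : _ - _ = ln n%:R ^+ 2); first exact: exprn_ge0.
by ring.
Qed.

(** Here [l = ln 2] and [L = ln n]. As [L >= l], the constant [c1] is at most [(c1 / l^2) L^2]; as
    [t >= 1], the factor [t] in front of [c + A / 2 + c1 / l^2] can only help, and the summand 1
    leaves [- t L^2]. *)
Lemma exponent_bound {R : realType} (l L A c c1 t : R) :
  0 < l -> l <= L -> 0 <= A -> 0 <= c -> 0 <= c1 -> 1 <= t ->
  c * L ^+ 2 + (A * L ^+ 2 / 2 +
    (- (t * (2 * (1 + c + A / 2 + c1 / l ^+ 2)) * L ^+ 2 / 2) + c1))
  <= - t * L ^+ 2.
Proof.
move=> l0 lL A0 c0 c10 t1.
have l2 : 0 < l ^+ 2 by rewrite exprn_gt0.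
have h1 : c1 <= c1 / l ^+ 2 * L ^+ 2.
  rewrite mulrAC -mulrA ler_peMr// ler_pdivlMr// mul1r.
  by rewrite lerXn2r// nnegrE ltW// (lt_le_trans l0).
have L0 : 0 <= L ^+ 2 by exact: sqr_ge0.
have d0 : 0 <= c1 / l ^+ 2 by rewrite divr_ge0// ltW.
set d := c1 / l ^+ 2 in h1 d0 *.
have : 0 <= (t - 1) * ((c + A / 2 + d) * L ^+ 2).
  by rewrite mulr_ge0 ?subr_ge0// mulr_ge0// !addr_ge0// divr_ge0.
lra.
Qed.

(** * From log-likelihoods to products of densities *)

Lemma loglik_EFin {R : realType} (f : R -> R) n (x : 'I_n -> R) :
  (forall i, 0 < f (x i)) -> loglik f x = (ln (\prod_(i < n) f (x i)))%:E.
Proof.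
move=> fx; have -> : ln (\prod_(i < n) f (x i)) = \sum_(i < n) ln (f (x i)).
  suff [//] : ln (\prod_(i < n) f (x i)) = \sum_(i < n) ln (f (x i)) /\
    0 < \prod_(i < n) f (x i).
  elim/big_ind2 : _ => [|u v u' v' [<- u0] [<- v0]|i _]; rewrite ?ln1//.
  by rewrite lnM ?posrE// mulr_gt0.
by rewrite /loglik -sumEFin; apply: eq_bigr => i _; rewrite lne_EFin.
Qed.

Lemma loglik_le0 {R : realType} (f : R -> R) n (x : 'I_n -> R) i :
  f (x i) <= 0 -> loglik f x = -oo%E.
Proof.
by move=> fx; apply/esum_eqNyP; exists i; split;
  rewrite ?mem_index_enum// le0_lneNy.
Qed.

(* In [\bar R], [-oo - -oo = -oo]; this is harmless because the likelihood of
   [f0] is positive. *)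
Lemma prod_le_of_loglik {R : realType} (f f0 : R -> R) n (x : 'I_n -> R) (a : R)
    (l : \bar R) :
  (forall i, 0 < f0 (x i)) -> (loglik f0 x <= l)%E ->
  (l - loglik f x <= a%:E)%E ->
  expR (- a) * \prod_(i < n) f0 (x i) <= \prod_(i < n) f (x i).
Proof.
move=> f0x; rewrite (loglik_EFin f0x) => f0l.
have [fx|/existsNP[i /negP]] := pselect (forall i, 0 < f (x i)); last first.
  rewrite -leNgt => fx0; rewrite (loglik_le0 fx0).
  by case: l f0l => [l| |].
rewrite (loglik_EFin fx) => lf.
have p0 : 0 < \prod_(i < n) f0 (x i) by exact: prodr_gt0.
have p1 : 0 < \prod_(i < n) f (x i) by exact: prodr_gt0.
case: l f0l lf => [l| |]//; rewrite -?EFinB !lee_fin => f0l lf.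
rewrite -ler_ln ?posrE ?mulr_gt0 ?expR_gt0// lnM ?posrE ?expR_gt0// expRK.
lra.
Qed.

(** * The exponential family over the probability with density [p0] *)

Section tilted_family.
Context {R : realType} (mu : {measure set R -> \bar R}) (p0 : R -> R).
Variables (nu : probability R R) (M : R).
Hypothesis mp0 : measurable_fun [set: R] p0.
Hypothesis p0_ge0 : forall x, 0 <= p0 x.
Hypothesis nuE : forall B, measurable B -> nu B = (\int[mu]_(x in B) (p0
  x)%:E)%E.
Hypothesis M0 : 0 < M.
Hypothesis MN : param_space M `<=` natural_space mu p0.

Lemma integral_mul_density (h : R -> R) :
  measurable_fun [set: R] h -> (forall x, 0 <= h x) ->
  (\int[mu]_x (h x * p0 x)%:E = \int[nu]_x (h x)%:E)%E.
Proof.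
move=> mh h0.
transitivity (\int[nu]_x ((EFin \o h) (id x) * cst 1 x))%E; last first.
  by apply: eq_integral => x _; rewrite mule1.
rewrite -(@eq_integral_weight _ _ _ _ _ _ _ mu nu id id (EFin \o p0)
  (cst 1%E) (EFin \o h))//.
- exact/measurable_EFinP.
- by move=> B mB; rewrite -nuE// integral_cst ?mul1e.
- exact/measurable_EFinP.
Qed.

Lemma partition_funE (t : R) : partition_fun mu p0 t = (\int[nu]_x (expR (t *
  x))%:E)%E.
Proof.
rewrite -integral_mul_density//.
by apply: (measurableT_comp (@measurable_expR R)); exact: measurable_funM.
Qed.

Lemma measurable_partition_fun : measurable_fun [set: R] (partition_fun mu p0).
Proof.
rewrite (_ : partition_fun mu p0 =
    fubini_G nu (fun z : R * R => (expR (z.2 * z.1))%:E)); last first.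
  by apply/funext => t; rewrite partition_funE.
apply: (@measurable_fun_fubini_tonelli_G _ _ _ _ _ nu
    (fun z : R * R => (expR (z.2 * z.1))%:E)).
  apply/measurable_EFinP; apply: (measurableT_comp (@measurable_expR R)).
  exact: measurable_funM.
by move=> z; rewrite lee_fin expR_ge0.
Qed.

Lemma measurable_kappa : measurable_fun [set: R] (kappa mu p0).
Proof.
apply: (measurableT_comp (@measurable_ln R)).
apply: (measurableT_comp (fine_measurable measurableT)).
exact: measurable_partition_fun.
Qed.

Lemma measurable_natural_space : measurable (natural_space mu p0).
Proof.
rewrite (_ : natural_space mu p0 = [set: R] `&` partition_fun mu p0 @^-1` (~`
  [set +oo%E])).
  by apply: measurable_partition_fun => //; apply: measurableC;
    exact: emeasurable_set1.
rewrite setTI; apply/seteqP; split => t /=; rewrite /natural_space/=.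
  by move=> + tE; rewrite tE ltxx.
by move/eqP; rewrite ltey.
Qed.

(** The cut-off makes the factor [1 / Z(t)] bounded on the whole line, so that integrals against any
    [g] make sense. *)
Definition expfam_weight (t : R) : R := expR (- kappa mu p0 t) *
  \1_(param_space M) t.

Lemma measurable_expfam_weight : measurable_fun [set: R] expfam_weight.
Proof.
apply: measurable_funM.
  apply: (measurableT_comp (@measurable_expR R)).
  by apply: measurableT_comp => //; exact: measurable_kappa.
by apply: measurable_indic; exact: measurable_param_space.
Qed.

Lemma expfam_weight_ge0 t : 0 <= expfam_weight t.
Proof. by rewrite mulr_ge0 ?expR_ge0. Qed.

Lemma expfam_weight_out t : ~ param_space M t -> expfam_weight t = 0.
Proof. by move=> tM; rewrite /expfam_weight indicE memNset ?mulr0. Qed.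

(** For [|t| <= M] the integrand [exp (t x)] is at least [exp (- M |x|)], whose [nu]-integral is
    positive and independent of [t]. This yields the bound on the weight. *)
Lemma partition_fun_lower : exists2 z : R, 0 < z &
  forall t, param_space M t -> (z%:E <= partition_fun mu p0 t)%E.
Proof.
pose h (x : R) := expR (- (M * `|x|)).
have mh : measurable_fun [set: R] h.
  apply: (measurableT_comp (@measurable_expR R)); apply: measurableT_comp => //.
  by apply: measurable_funM => //; exact: measurableT_comp.
pose J := (\int[nu]_x (h x)%:E)%E.
have J0 : (0 <= J)%E by apply: integral_ge0 => x _; rewrite lee_fin expR_ge0.
have J1 : (J <= 1)%E.
  apply: (@le_trans _ _ (\int[nu]_x (cst 1 x))%E).
    apply: (ge0_le_integral_real nu (g := cst 1)) => // x;
      first exact: expR_ge0.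
    by rewrite expR_le1 oppr_le0 mulr_ge0// ltW.
  by rewrite integral_cst// mul1e; exact: probability_le1.
have Jne0 : J != 0%E.
  apply/eqP => J00.
  have : ae_eq nu [set: R] (EFin \o h) (cst 0%E).
    apply/ae_eq_integral_abs => //; first exact/measurable_EFinP.
    rewrite -[RHS]J00; apply: eq_integral => x _.
    by rewrite gee0_abs// lee_fin expR_ge0.
  move=> [N [mN N0 hN]].
  (* [h] vanishes nowhere, so if its integral were 0 the whole line would be [nu]-null. *)
  have NT : N = [set: R].
    apply/seteqP; split => // x _; apply: hN => /= /(_ I) [] /eqP.
    by rewrite gt_eqF// expR_gt0.
  have : nu [set: R] = 1%E by exact: probability_setT.
  by rewrite -NT N0 => /eqP; rewrite eq_sym onee_eq0.
have Jfin : J \is a fin_num by rewrite ge0_fin_numE// (le_lt_trans J1)// ltry.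
exists (fine J); first by rewrite fine_gt0// lt0e Jne0 J0 (le_lt_trans J1)//
  ltry.
move=> t tM; rewrite fineK// partition_funE.
apply: ge0_le_integral_real => // [x||x]; first exact: expR_ge0.
  by apply: (measurableT_comp (@measurable_expR R)); exact: measurable_funM.
rewrite ler_expR lerNl (le_trans (ler_norm _))// normrN normrM.
by rewrite ler_wpM2r.
Qed.

Lemma expR_kappa t z : 0 < z -> (z%:E <= partition_fun mu p0 t)%E ->
  natural_space mu p0 t ->
  (expR (kappa mu p0 t))%:E = partition_fun mu p0 t.
Proof.
rewrite /natural_space/= /kappa; case: (partition_fun mu p0 t) => [v| |]// z0.
by rewrite lee_fin /= => zv _; rewrite lnK// posrE (lt_le_trans z0).
Qed.

Lemma expfam_weight_bound : exists2 E : R, 0 <= E & forall t, expfam_weight t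
  <= E.
Proof.
have [z z0 zP] := partition_fun_lower; exists z^-1;
  first by rewrite invr_ge0 ltW.
move=> t; have [tM|tM] := pselect (param_space M t); last first.
  by rewrite expfam_weight_out// invr_ge0 ltW.
rewrite /expfam_weight indicE mem_set// mulr1 expRN lef_pV2 ?posrE ?expR_gt0//.
by rewrite -lee_fin (expR_kappa z0 (zP _ tM) (MN tM)) zP.
Qed.

Lemma expfam_weight_partition t :
  ((expfam_weight t)%:E * \int[nu]_x (expR (t * x))%:E <= 1)%E.
Proof.
have [tM|tM] := pselect (param_space M t);
  last by rewrite expfam_weight_out ?mul0e.
have [z z0 zP] := partition_fun_lower.
rewrite -partition_funE -(expR_kappa z0 (zP _ tM) (MN tM)) -EFinM lee_fin.
by rewrite /expfam_weight indicE mem_set// mulr1 -expRD addNr expR0.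
Qed.

(** For [g]-almost every [t] in the line, [t] lies in the parameter space, where neither the
    restriction to the natural space nor the cut-off of the weight changes the integrand. *)
Lemma mixture_exp_mixture (g : probability R R) x : mixing M g ->
  mixture mu p0 g x = exp_mixture expfam_weight g x * p0 x.
Proof.
move=> gM; have [E E0 WE] := expfam_weight_bound.
rewrite /exp_mixture -RintegralZr//; last first.
  exact: (integrable_exp_weight measurable_expfam_weight expfam_weight_ge0 WE
    expfam_weight_out).
rewrite /mixture Rintegral_mkcond; congr fine; apply: ae_eq_integral => //.
- apply/measurable_EFinP; apply/(measurable_restrictT _ _).1.
    exact: measurable_natural_space.
  apply: measurable_funTS; rewrite /expfam; apply: measurable_funM => //.
  apply: (measurableT_comp (@measurable_expR R)); apply: measurable_funB.
    exact: measurable_funM.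
  exact: measurable_kappa.
- apply/measurable_EFinP; apply: measurable_funM => //; apply: measurable_funM.
    exact: measurable_expRM.
  exact: measurable_expfam_weight.
- apply: filterS (mixing_ae_param_space gM) => t tM _ /=; congr EFin.
  rewrite patchE mem_set; last exact: MN.
  by rewrite /expfam /expfam_weight indicE mem_set// mulr1 expRD.
Qed.

End tilted_family.

(** * Brackets for the mixture densities and the Hellinger deviation bound *)

(** The family [f] extends the mixture densities to all probabilities [g], as subdensities, so that
    cells are defined on the whole type. *)
Lemma mixture_brackets {R : realType} (mu : {measure set R -> \bar R})
    (p0 : R -> R) (M tau : R) :
  is_density mu p0 -> 0 < M -> param_space M `<=` natural_space mu p0 ->
  0 < tau -> `[- M - tau, M + tau] `<=` natural_space mu p0 ->
  exists (f : probability R R -> R -> R) (c c1 : R),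
    [/\ forall g, mixing M g -> mixture mu p0 g = f g,
        forall g, measurable_fun [set: R] (f g),
        forall g x, 0 <= f g x,
        (forall g, \int[mu]_x (f g x)%:E <= 1)%E &
    [/\ 0 < c, 0 <= c1 & forall n, (2 <= n)%N ->
      exists (J : finType) (cell : probability R R -> J) (r : R -> R),
      [/\ #|J|%:R <= expR (c * ln n%:R ^+ 2),
          measurable_fun [set: R] r, forall x, 0 <= r x,
          (\int[mu]_x (r x)%:E <= (c1 / n%:R ^+ 2)%:E)%E &
          forall g h, cell g = cell h -> forall x, f g x <= f h x + r x]]].
Proof.
move=> [mp0 p0_ge0 p01] M0 MN tau0 MtN.
have [nu nuE] := exists_probability_density mp0 p0_ge0 p01.
have mW := measurable_expfam_weight M mp0 p0_ge0 nuE.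
have W0 := expfam_weight_ge0 mu p0 M.
have Wout := @expfam_weight_out _ mu p0 M.
have [E E0 WE] := expfam_weight_bound mp0 p0_ge0 nuE M0 MN.
have Wnu := expfam_weight_partition mp0 p0_ge0 nuE M0 MN.
set W := expfam_weight mu p0 M in mW W0 Wout WE Wnu.
(* The envelope is at most [exp ((M + tau) x) + exp (- (M + tau) x)]; both exponents are endpoints
   of the interval inside the natural space, so it is [nu]-integrable. *)
pose env (x : R) := expR ((M + tau) * `|x|).
have menv : measurable_fun [set: R] env.
  apply: (measurableT_comp (@measurable_expR R)).
  by apply: measurable_funM => //; exact: measurableT_comp.
have env0 x : 0 <= env x by exact: expR_ge0.
have [Z1 Z10 envZ] : exists2 Z1 : R, 0 <= Z1 & (\int[nu]_x (env x)%:E <=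
  Z1%:E)%E.
  have mexp (t : R) : measurable_fun [set: R] (fun x => expR (t * x)).
    by apply: (measurableT_comp (@measurable_expR R)); exact: measurable_funM.
  have Zle : (\int[nu]_x (env x)%:E <=
      partition_fun mu p0 (M + tau) + partition_fun mu p0 (- M - tau))%E.
    rewrite !(partition_funE mp0 p0_ge0 nuE) -ge0_integralD_real//.
    apply: ge0_le_integral_real => //; first exact: measurable_funD.
    move=> x; rewrite /env; have [x0|x0] := leP 0 x.
      by rewrite ler_wpDr ?expR_ge0// ler_expR ger0_norm.
    rewrite ler_wpDl ?expR_ge0// ler_expR ltr0_norm//; lra.
  have Zfin t : - M - tau <= t <= M + tau -> partition_fun mu p0 t \is a
    fin_num.
    move=> tM; rewrite ge0_fin_numE.
      by apply: MtN; rewrite /= in_itv.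
    rewrite (partition_funE mp0 p0_ge0 nuE); apply: integral_ge0 => x _.
    by rewrite lee_fin expR_ge0.
  have Z1 := Zfin (M + tau); have Z2 := Zfin (- M - tau).
  have {Z1 Z2} Z12 : (partition_fun mu p0 (M + tau) +
      partition_fun mu p0 (- M - tau))%E \is a fin_num.
    by rewrite fin_numD Z1 ?Z2//; apply/andP; split; lra.
  exists (fine (partition_fun mu p0 (M + tau) + partition_fun mu p0 (- M -
    tau))%E).
    rewrite fine_ge0// (le_trans _ Zle)//; apply: integral_ge0 => x _.
    by rewrite lee_fin.
  by rewrite fineK.
(* With this ratio [M |x| / rho] is the exponent of [env]; [tau > 0] gives [rho < 1]. *)
pose rho := M / (M + tau).
have rho0 : 0 < rho by rewrite divr_gt0// addr_gt0.
have rho1 : rho < 1 by rewrite ltr_pdivrMr ?addr_gt0// mul1r ltrDl.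
have E20 : 0 <= 2 * E by rewrite mulr_ge0.
have [c c0 cP] := exists_moment_grid rho0 rho1 E20.
exists (fun g x => exp_mixture W g x * p0 x), c, ((1 + 2 * E) * Z1).
have mf g : measurable_fun [set: R] (exp_mixture W g).
  exact: (measurable_exp_mixture mW W0 WE Wout).
split.
- move=> g gM; apply/funext => x.
  exact: (mixture_exp_mixture mp0 p0_ge0 nuE M0 MN).
- by move=> g; exact: measurable_funM.
- by move=> g x; rewrite mulr_ge0// exp_mixture_ge0.
- move=> g; rewrite (integral_mul_density mp0 p0_ge0 nuE)//.
    exact: (integral_exp_mixture_le1 mW W0 WE Wout Wnu).
  by move=> x; exact: exp_mixture_ge0.
split=> //; first by rewrite mulr_ge0// addr_ge0.
move=> n n2; have n0 : 0 < n%:R ^+ 2 :> R.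
  by rewrite exprn_gt0// ltr0n; exact: leq_trans n2.
have [K [N [rhoK EN NK]]] := cP n n2.
have [||cell cellP] := @exp_mixture_cells R W M E M0 mW W0 WE Wout rho
  (n%:R ^+ 2)^-1 K N rho0 (ltW rho1).
- by rewrite invr_gt0.
- by rewrite invrK.
(* The grid step plus twice the truncation error, hence at most [(1 + 2 E) / n^2]. *)
pose eta := (n%:R ^+ 2)^-1 + 2 * E * rho ^+ K.
have eta0 : 0 <= eta.
  by rewrite addr_ge0 ?invr_ge0 ?(ltW n0)// mulr_ge0// exprn_ge0// ltW.
have etale : eta <= (1 + 2 * E) / n%:R ^+ 2.
  by rewrite mulrDl mul1r lerD2l ler_wpM2l.
exists {ffun 'I_K -> 'I_N.+1}, cell, (fun x => (eta * env x) * p0 x); split.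
- by rewrite card_ffun !card_ord.
- by apply: measurable_funM => //; exact: measurable_funM.
- by move=> x; rewrite mulr_ge0// mulr_ge0.
- rewrite (integral_mul_density mp0 p0_ge0 nuE)//; last 2 first.
  + exact: measurable_funM.
  + by move=> x; rewrite mulr_ge0.
  rewrite ge0_integralZl_real// mulrAC EFinM; apply: lee_pmul => //.
  + by apply: integral_ge0 => x _; rewrite lee_fin.
- move=> g h gh x; rewrite -mulrDl ler_wpM2r//.
  have := cellP g h gh x; rewrite -/eta (_ : M * `|x| / rho = (M + tau) *
    `|x|)//.
  by rewrite /rho; field; rewrite !gt_eqF// addr_gt0.
Qed.

Theorem theorem2p2 (R : realType) (mu : {measure set R -> \bar R}) (p0 : R -> R)
    (M A : R) :
  is_density mu p0 ->
  0 < M ->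
  param_space M `<=` natural_space mu p0 ->
  (exists2 tau : R, 0 < tau &
     `[- M - tau, M + tau] `<=` natural_space mu p0) ->
  0 < A ->
  exists2 C : R, 0 < C &
    forall (d : measure_display) (Omega : measurableType d)
      (P : probability Omega R) (n : nat) (X : 'I_n -> {RV P >-> R})
      (g0 : probability R R) (ghat gtilde : ('I_n -> R) -> probability R R),
    (1 <= n)%N ->
    mixing M g0 ->
    iid_density X mu (mixture mu p0 g0) ->
    (forall x, is_npmle mu p0 M x (ghat x)) ->
    (forall x, mixing M (gtilde x)) ->
    (\forall w \ae P,
       let x := fun i => X i w in
       (loglik (mixture mu p0 (ghat x)) x -
          loglik (mixture mu p0 (gtilde x)) x
        <= (A * ln n%:R ^+ 2)%:E)%E) ->
    let loss w :=
      hellinger2 mu (mixture mu p0 (gtilde (fun i => X i w)))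
                    (mixture mu p0 g0) in
    measurable_fun [set: Omega] loss ->
    forall t : R, 1 <= t ->
      (P [set w | ((t * C * (ln n%:R ^+ 2 / n%:R))%:E <= loss w)%E]
       <= (expR (- t * ln n%:R ^+ 2))%:E)%E.
Proof.
move=> dp0 M0 MN [tau tau0 MtN] A0.
have [f [c [c1 [mixE mf f_ge0 f1 [c0 c10 brackets]]]]] :=
  mixture_brackets dp0 M0 MN tau0 MtN.
have ln2 : 0 < ln 2 :> R by rewrite ln_gt0 ?ltr1n.
have d0 : 0 <= (c1 + 1) / 2 / ln 2 ^+ 2.
  by rewrite !divr_ge0 ?addr_ge0// exprn_ge0// ltW.
(* The terms pay for the target exponent, the number of cells, the likelihood gap, and the bracket
   error [(c1 + 1) / 2], which is bounded in [n] and is measured against [(ln 2)^2 <= (ln n)^2]. *)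
exists (2 * (1 + c + A / 2 + (c1 + 1) / 2 / ln 2 ^+ 2)).
  by rewrite mulr_gt0// ltr_wpDr// ltr_wpDr ?divr_ge0 ?(ltW A0)// addr_gt0.
set C := 2 * _ => d Omega P n X g0 ghat gtilde n1 g0M iidX npmle gtM approx
  loss mloss t t1.
have mS (y : \bar R) : measurable [set w | (y <= loss w)%E].
  by rewrite -[X in measurable X]setTI; exact: emeasurable_fun_c_infty.
(* For [n = 1] the logarithm is 0 and the claimed bound is 1. *)
have [n2|] := leqP 2 n; last first.
  rewrite ltnS => n1'; have -> : n = 1%N by apply/eqP; rewrite eqn_leq n1'.
  by rewrite ln1 expr0n/= mulr0 expR0; exact: probability_le1.
have n0 : 0 < n%:R :> R by rewrite ltr0n.
have [J [cell [r [Jle mr r0 r1 cellP]]]] := brackets n n2.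
rewrite (mixE _ g0M) in iidX.
(* Since [r] has mass at most [c1 / n^2], the choice [b = n] makes the bracket error per observation
   [(c1 + 1) / (2 n)]. *)
apply: le_trans (bracketing_tail (a := A * ln n%:R ^+ 2) (b := n%:R)
  (s := t * C * (ln n%:R ^+ 2 / n%:R))
  (gam := fun w => gtilde (fun i => X i w)) iidX mf f_ge0 f1 (mf g0) (f_ge0 g0)
  (f1 g0) mr r0 r1 n0 cellP (mS _) _ _) _.
- by move=> w /=; rewrite /loss (mixE _ g0M) (mixE _ (gtM _)).
- apply: filterS2 (ae_sample_density_gt0 iidX (mf g0) (f_ge0 g0)) approx.
  move=> w f0w /= lik _; have [_ ghat_max] := npmle (fun i => X i w).
  (* The maximizer only serves as a bridge: its likelihood is at least that of [g0], so the
     likelihood of [gtilde] is compared with that of the true density. *)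
  have := ghat_max _ g0M; rewrite (mixE _ g0M) => le_lik.
  rewrite (mixE _ (gtM _)) in lik.
  exact: (prod_le_of_loglik f0w le_lik lik).
rewrite lee_fin; apply: (@le_trans _ _ (expR (c * ln n%:R ^+ 2) * expR (A * ln
  n%:R ^+ 2 / 2 +
   (- (t * C * ln n%:R ^+ 2 / 2) + (c1 + 1) / 2)))).
  rewrite ler_pM ?expR_ge0// ler_expR lerD2l.
  rewrite le_eqVlt; apply/orP; left; apply/eqP; field.
  by rewrite gt_eqF.
rewrite -expRD ler_expR; apply: exponent_bound => //.
- by rewrite ler_ln ?posrE ?ltr0n// ler_nat.
- exact: ltW.
- exact: ltW.
- by rewrite divr_ge0// addr_ge0.
Qed.
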